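(* Let $S$ be a set of $n$ line segments in the plane whose directions take at most $k$ distinct values (slopes). Then a hitting set for $S$ whose cardinality is at most $k$ times the minimum cardinality of a hitting set for $S$ can be computed in $O(n\log n)$ time.
   Context: A hitting set for a family of subsets of the plane (segments, rays, lines) is a finite set of points of the plane such that every member of the family contains at least one of the points. Segments are closed and may overlap arbitrarily. *)

(* Defs.v *)
From HB Require Import structures.
From mathcomp Require Import all_boot all_order all_algebra.
From mathcomp Require Import reals.
Set Implicit Arguments. Unset Strict Implicit. Unset Printing Implicit Defensive.
Import Order.TTheory GRing.Theory Num.Theory.
Local Open Scope ring_scope.

Section Geom.
Variable R : realType.

Definition point := (R * R)%type.
Definition segment := (point * point)%type.

Definition on_seg (p : point) (s : segment) : Prop :=
  exists t : R, 0 <= t /\ t <= 1 /\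
    p = ((1 - t) * s.1.1 + t * s.2.1, (1 - t) * s.1.2 + t * s.2.2).

Definition hits (S : seq segment) (H : seq point) : Prop :=
  forall s, s \in S -> exists2 p, p \in H & on_seg p s.

Definition nondeg (s : segment) : bool := s.1 != s.2.

Definition has_dir (s : segment) (d : point) : Prop :=
  (s.2.1 - s.1.1) * d.2 - (s.2.2 - s.1.2) * d.1 = 0.

Definition at_most_k_dirs (k : nat) (S : seq segment) : Prop :=
  exists D : seq point, (size D <= k)%N /\ (forall d, d \in D -> d != (0, 0)) /\
    forall s, s \in S -> exists2 d, d \in D & has_dir s d.
End Geom.

(*  - integer  + -,  real  + - * /  (x/0 = 0),  comparisons,          *)
(*  - direct and indirect addressing; each instruction costs 1.       *)
Inductive instr :=
| IConst of int & int
| IAdd of int & int & int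
| ISub of int & int & int
| ILoad of int & int
| IStore of int & int
| RConst of int & int
| RAdd of int & int & int
| RSub of int & int & int
| RMul of int & int & int
| RDiv of int & int & int
| RLoad of int & int
| RStore of int & int
| JILt of int & int & nat
| JRLt of int & int & nat
| Jmp of nat
| Halt.

Definition program := seq instr.

Record state (R : realType) := St { pc : nat; imem : int -> int; rmem : int -> R }.

Definition upd {T : Type} (f : int -> T) (a : int) (v : T) : int -> T :=
  fun x => if x == a then v else f x.

Section Exec.
Variable R : realType.
Variable P : program.

Definition step (s : state R) : state R :=
  let: St p M X := s in
  let nxt := p.+1 in
  match nth Halt P p with
  | IConst d c => St nxt (upd M d c) X
  | IAdd d a b => St nxt (upd M d (M a + M b)) X
  | ISub d a b => St nxt (upd M d (M a - M b)) X
  | ILoad d a => St nxt (upd M d (M (M a))) X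
  | IStore a s => St nxt (upd M (M a) (M s)) X
  | RConst d c => St nxt M (upd X d (c%:~R))
  | RAdd d a b => St nxt M (upd X d (X a + X b))
  | RSub d a b => St nxt M (upd X d (X a - X b))
  | RMul d a b => St nxt M (upd X d (X a * X b))
  | RDiv d a b => St nxt M (upd X d (X a / X b))
  | RLoad d a => St nxt M (upd X d (X (M a)))
  | RStore a s => St nxt M (upd X (M a) (X s))
  | JILt a b t => St (if M a < M b then t else nxt) M X
  | JRLt a b t => St (if X a < X b then t else nxt) M X
  | Jmp t => St t M X
  | Halt => s
  end.

(* the machine has stopped: the current instruction is Halt (this
   includes running off the end of the program) *)
Definition halted (s : state R) : bool :=
  if nth Halt P (pc s) is Halt then true else false.
End Exec.

(* Input encoding: I[0] = n, X[4i..4i+3] = ax, ay, bx, by of segment i,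
   all other cells 0; execution starts at instruction 0. *)
Definition coord (R : realType) (s : segment R) (j : nat) : R :=
  match j with 0 => s.1.1 | 1 => s.1.2 | 2 => s.2.1 | _ => s.2.2 end.

Definition init_state (R : realType) (S : seq (segment R)) : state R :=
  St 0 (fun x => if x == 0 then (size S)%:Z else 0)
       (fun x => match x with
                 | Posz m => if (m %/ 4 < size S)%N
                             then coord (nth ((0, 0), (0, 0)) S (m %/ 4)%N) (m %% 4)%N
                             else 0
                 | Negz _ => 0
                 end).

(* Output decoding: I[0] = m (number of points, negatives read as 0),
   point j is (X[2j], X[2j+1]) for j < m. *)
Definition output (R : realType) (s : state R) : seq (point R) :=
  let m := match imem s 0 with Posz m => m | Negz _ => 0%N end in
  [seq (rmem s (2 * j)%N%:Z, rmem s (2 * j + 1)%N%:Z) | j <- iota 0 m].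

(* Main.v *)
(** Attach to every segment of slope m on the line y = m x + c the two
    lexicographic keys (v, m, c, l) and (v, m, c, r), where [l, r] is its
    projection to an axis and v separates vertical from other directions.
    Segments become intervals of one linear order, and a segment is hit by the
    upper endpoint of another one as soon as the upper key of the latter lies
    in the interval.  Sort by upper key and scan, outputting an upper endpoint
    whenever the last output key lies below the current interval.  The output
    intervals are pairwise disjoint, and each contains the key of some pair
    (direction, point of H) for any hitting set H, so there are at most k |H|
    of them.  Sorting is bottom-up merge sort on pointers to records. *)
Require Import Defs.
From HB Require Import structures.
From mathcomp Require Import all_boot all_order all_algebra.
From mathcomp Require Import reals.
From mathcomp Require Import zify ring lra.
Set Implicit Arguments. Unset Strict Implicit. Unset Printing Implicit Defensive.
Import Order.TTheory GRing.Theory Num.Theory.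
Local Open Scope ring_scope.

(** * A structured language over the machine, with time budgets *)

(** The two keys of a segment share their first three entries, which determine its line. A key
    between them therefore belongs to the same line, and comparisons across different lines never
    produce a false hit. The factor k enters only through the analysis: a point of H lies on one
    line per direction and so accounts for at most k keys, while greedy stabbing is optimal in a
    linear order. The program reads neither k nor the directions, so it can be fixed before both.
    The convention x / 0 = 0 lets straight-line arithmetic treat vertical segments without a branch.
    The remaining obstacle is cost on a concrete machine with absolute jumps: programs are written
    in a structured language whose Hoare-style rules carry a number of steps, so that correctness
    and running time are proved together. *)

Inductive cmd :=
| Skip
| Do of instr
| Seq of cmd & cmd
| IfI of int & int & cmd & cmd
| IfR of int & int & cmd & cmd
| While of int & int & cmd.

Notation "c1 ;; c2" := (Seq c1 c2) (at level 61, right associativity).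

Fixpoint len (c : cmd) : nat :=
  match c with
  | Skip => 0
  | Do _ => 1
  | Seq c1 c2 => len c1 + len c2
  | IfI _ _ c1 c2 | IfR _ _ c1 c2 => len c2 + len c1 + 2
  | While _ _ c => len c + 3
  end.

(** Jump targets are absolute, hence the start address [p]. The else-branch comes first because a
    failed test falls through. Since [len] does not depend on the address, targets are known before
    the code is laid out. *)
Fixpoint compile (p : nat) (c : cmd) : program :=
  match c with
  | Skip => [::]
  | Do i => [:: i]
  | Seq c1 c2 => compile p c1 ++ compile (p + len c1)%N c2
  | IfI a b c1 c2 =>
      JILt a b (p + len c2 + 2)%N ::
      compile p.+1 c2 ++ Jmp (p + len c2 + len c1 + 2)%N :: compile (p + len c2 + 2)%N c1
  | IfR a b c1 c2 =>
      JRLt a b (p + len c2 + 2)%N ::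
      compile p.+1 c2 ++ Jmp (p + len c2 + len c1 + 2)%N :: compile (p + len c2 + 2)%N c1
  | While a b c =>
      JILt a b p.+2 :: Jmp (p + len c + 3)%N :: rcons (compile p.+2 c) (Jmp p)
  end.

Lemma size_compile p c : size (compile p c) = len c.
Proof.
elim: c p => //= [c1 IH1 c2 IH2|a b c1 IH1 c2 IH2|a b c1 IH1 c2 IH2|a b c IH] p.
- by rewrite size_cat IH1 IH2.
- by rewrite size_cat /= IH1 IH2 addnS addn2.
- by rewrite size_cat /= IH1 IH2 addnS addn2.
- by rewrite size_rcons IH addn3.
Qed.

Definition straight (i : instr) : bool :=
  match i with JILt _ _ _ | JRLt _ _ _ | Jmp _ | Halt => false | _ => true end.

Definition code_at (P : program) (p : nat) (c : program) : Prop :=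
  forall i, (i < size c)%N -> nth Halt P (p + i)%N = nth Halt c i.

Lemma code_at_cat P p c1 c2 :
  code_at P p (c1 ++ c2) -> code_at P p c1 /\ code_at P (p + size c1)%N c2.
Proof.
move=> H; split=> i Hi.
  by rewrite H ?size_cat ?nth_cat ?Hi // ltn_addr.
by rewrite -addnA H ?size_cat ?ltn_add2l // nth_cat ltnNge leq_addr /= addKn.
Qed.

Lemma code_at_cons P p i c :
  code_at P p (i :: c) -> nth Halt P p = i /\ code_at P p.+1 c.
Proof.
move=> H; split; first by move: (H 0%N isT); rewrite addn0.
by move=> j Hj; rewrite addSnnS H.
Qed.

Section WP.
Variable R : realType.
Implicit Types (M : int -> int) (X : int -> R).

Definition exec_int (i : instr) M X : int -> int :=
  match i with
  | IConst d c => upd M d c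
  | IAdd d a b => upd M d (M a + M b)
  | ISub d a b => upd M d (M a - M b)
  | ILoad d a => upd M d (M (M a))
  | IStore a s => upd M (M a) (M s)
  | _ => M
  end.

Definition exec_real (i : instr) M X : int -> R :=
  match i with
  | RConst d c => upd X d c%:~R
  | RAdd d a b => upd X d (X a + X b)
  | RSub d a b => upd X d (X a - X b)
  | RMul d a b => upd X d (X a * X b)
  | RDiv d a b => upd X d (X a / X b)
  | RLoad d a => upd X d (X (M a))
  | RStore a s => upd X (M a) (X s)
  | _ => X
  end.

Lemma step_straight P p i M X : straight i -> nth Halt P p = i ->
  step P (St p M X) = St p.+1 (exec_int i M X) (exec_real i M X).
Proof. by rewrite /= => + ->; case: i. Qed.

(* Started with time budget n, wherever the compiled code is placed, the
   command ends in a state satisfying Q, whose first argument is the part of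
   the budget that is left. *)
Definition wp (c : cmd) (n : nat)
    (Q : nat -> (int -> int) -> (int -> R) -> Prop) M X : Prop :=
  forall P p, code_at P p (compile p c) -> exists t M' X', [/\ (t <= n)%N,
    iter t (step P) (St p M X) = St (p + len c)%N M' X' & Q (n - t)%N M' X'].

Lemma wp_post c n (Q Q' : nat -> _ -> _ -> Prop) M X :
  wp c n Q M X -> (forall n' M' X', Q n' M' X' -> Q' n' M' X') -> wp c n Q' M X.
Proof.
move=> H QQ' P p cP; have [t [M' [X' [tm E q]]]] := H P p cP.
by exists t, M', X'; split=> //; apply: QQ' q.
Qed.

Lemma wp_skip n (Q : nat -> _ -> _ -> Prop) M X : Q n M X -> wp Skip n Q M X.
Proof. by move=> q P p _; exists 0%N, M, X; rewrite addn0 subn0. Qed.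

Lemma wp_do i n (Q : nat -> _ -> _ -> Prop) M X : straight i ->
  Q n (exec_int i M X) (exec_real i M X) -> wp (Do i) n.+1 Q M X.
Proof.
move=> si q P p /code_at_cons[cP _]; exists 1%N.
exists (exec_int i M X), (exec_real i M X); split=> //; last by rewrite subn1.
by rewrite iterS /iter (step_straight _ _ si cP) addn1.
Qed.

Lemma wp_seq c1 c2 n Q M X :
  wp c1 n (fun m => wp c2 m Q) M X -> wp (c1;; c2) n Q M X.
Proof.
move=> H P p /code_at_cat[cP1]; rewrite size_compile => cP2.
have [t1 [M1 [X1 [le1 E1 W2]]]] := H P p cP1.
have [t2 [M2 [X2 [le2 E2 q]]]] := W2 P _ cP2.
exists (t2 + t1)%N, M2, X2; split; first lia.
  by rewrite iterD E1 E2 /= addnA.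
by rewrite addnC subnDA.
Qed.

Lemma wp_do_seq i c n Q M X : straight i ->
  wp c n Q (exec_int i M X) (exec_real i M X) -> wp (Do i;; c) n.+1 Q M X.
Proof. by move=> si H; apply: wp_seq; apply: wp_do. Qed.

Lemma wp_ifI a b c1 c2 n Q M X :
  (M a < M b -> wp c1 n.+1 Q M X) -> (~~ (M a < M b) -> wp c2 n Q M X) ->
  wp (IfI a b c1 c2) n.+2 Q M X.
Proof.
move=> H1 H2 P p /code_at_cons[i0 /code_at_cat[cP2 /code_at_cons[i1 cP1]]].
rewrite size_compile in i1 cP1.
have e : ((p.+1 + len c2).+1 = p + len c2 + 2)%N by lia.
rewrite e in cP1.
have [ab|ab] := boolP (M a < M b).
  have [t [M' [X' [le_t E q]]]] := H1 ab P _ cP1; exists t.+1, M', X'; split=> //.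
  by rewrite iterSr /= i0 ab E /=; congr St; lia.
have [t [M' [X' [le_t E q]]]] := H2 ab P _ cP2.
exists (1 + (t + 1))%N, M', X'; split; first lia; last first.
  by rewrite addnC !addn1.
rewrite 2!iterD [iter 1 _ (St p M X)]/= i0 (negbTE ab) E /=.
by rewrite i1; congr St; lia.
Qed.

Lemma wp_ifR a b c1 c2 n Q M X :
  (X a < X b -> wp c1 n.+1 Q M X) -> (~~ (X a < X b) -> wp c2 n Q M X) ->
  wp (IfR a b c1 c2) n.+2 Q M X.
Proof.
move=> H1 H2 P p /code_at_cons[i0 /code_at_cat[cP2 /code_at_cons[i1 cP1]]].
rewrite size_compile in i1 cP1.
have e : ((p.+1 + len c2).+1 = p + len c2 + 2)%N by lia.
rewrite e in cP1.
have [ab|ab] := boolP (X a < X b).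
  have [t [M' [X' [le_t E q]]]] := H1 ab P _ cP1; exists t.+1, M', X'; split=> //.
  by rewrite iterSr /= i0 ab E /=; congr St; lia.
have [t [M' [X' [le_t E q]]]] := H2 ab P _ cP2.
exists (1 + (t + 1))%N, M', X'; split; first lia; last first.
  by rewrite addnC !addn1.
rewrite 2!iterD [iter 1 _ (St p M X)]/= i0 (negbTE ab) E /=.
by rewrite i1; congr St; lia.
Qed.

(** The invariant is indexed by the steps still allowed: [k] pays for one run of the body, [m'] for
    the later rounds, and 2 for the test and a jump (back, or out of the loop). As [m'] is smaller
    than [m], termination comes with the time bound, by induction on [m]. *)
Lemma wp_while (I : nat -> (int -> int) -> (int -> R) -> Prop) a b c
    (Q : (int -> int) -> (int -> R) -> Prop) :
  (forall m M X, I m M X -> M a < M b -> exists k m',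
     (k + m' + 2 <= m)%N /\ wp c k (fun _ => I m') M X) ->
  (forall m M X, I m M X -> ~~ (M a < M b) -> (2 <= m)%N /\ Q M X) ->
  forall m M X, I m M X -> wp (While a b c) m (fun _ => Q) M X.
Proof.
move=> Hbody Hexit; elim/ltn_ind=> m IH M X Im P p /[dup] cW.
move=> /code_at_cons[i0 /code_at_cons[i1]]; rewrite -cats1.
move=> /code_at_cat[cP /code_at_cons[i2 _]]; rewrite size_compile in i2.
have [ab|ab] := boolP (M a < M b).
  have [k [m' [le_m /(_ _ _ cP)[t1 [M1 [X1 [le1 E1 q1]]]]]]] := Hbody _ _ _ Im ab.
  have [|t2 [M2 [X2 [le2 E2 q2]]]] := IH m' _ _ _ q1 P p cW; first lia.
  exists (t2 + (1 + (t1 + 1)))%N, M2, X2; split=> //; first lia.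
  rewrite 3!iterD [iter 1 _ (St p M X)]/= i0 ab E1 [iter 1 _ _]/= i2.
  by rewrite E2 /= .
have [le_m q] := Hexit _ _ _ Im ab.
exists 2, M, X; split=> //=.
by rewrite i0 (negbTE ab) /= i1 addnA.
Qed.

(** The postcondition must be blind to the leftover budget, because a larger budget also changes
    what is left. *)
Lemma wp_le c m n Q M X : (m <= n)%N ->
  wp c m (fun _ => Q) M X -> wp c n (fun _ => Q) M X.
Proof.
move=> le_mn H P p cP; have [t [M' [X' [tm E q]]]] := H P p cP.
by exists t, M', X'; split=> //; apply: leq_trans le_mn.
Qed.

Lemma wp_seq_mid A c1 c2 k1 k2 n Q M X : (k1 + k2 <= n)%N ->
  wp c1 k1 (fun _ => A) M X ->
  (forall M' X', A M' X' -> wp c2 k2 (fun _ => Q) M' X') ->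
  wp (c1;; c2) n (fun _ => Q) M X.
Proof.
move=> le_n H1 H2; apply: wp_le le_n _; apply: wp_seq => P p cP.
have [t [M' [X' [tm E q]]]] := H1 P p cP.
exists t, M', X'; split=> //; first exact: leq_trans (leq_addr _ _).
by apply: wp_le (H2 _ _ q); lia.
Qed.

(** Execution ends just past the code, where [nth] returns its default [Halt]. *)
Lemma wp_halts c n Q M X : wp c n Q M X -> exists t, (t <= n)%N /\
  let s := iter t (step (compile 0 c)) (St 0 M X) in
  halted (compile 0 c) s /\ exists m, Q m (imem s) (rmem s).
Proof.
case/(_ (compile 0 c) 0%N) => [//|t [M' [X' [le_t E q]]]].
exists t; split=> //=; rewrite E; split; last by exists (n - t)%N.
by rewrite /halted nth_default // size_compile.
Qed.
End WP.

(** * Greedy stabbing in a linear order *)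

Section Greedy.
Variables (d : Order.disp_t) (K : orderType d) (T : eqType) (L U : T -> K) (x0 : T).

(** [x0] plays the last output while there is none; the lemmas below put [U x0] under every [L x],
    so the first element is always kept. *)
Definition greedy_step (out : seq T) (x : T) : seq T :=
  if (U (last x0 out) < L x)%O then rcons out x else out.

Definition greedy (s : seq T) : seq T := foldl greedy_step [::] s.

Lemma greedy_rcons s x : greedy (rcons s x) = greedy_step (greedy s) x.
Proof. by rewrite /greedy foldl_rcons. Qed.

Lemma greedy_sub s : {subset greedy s <= s}.
Proof.
elim/last_ind: s => // s x IH y; rewrite greedy_rcons /greedy_step mem_rcons inE.
case: ifP => _; last by move/IH->; rewrite orbT.
by rewrite mem_rcons inE => /orP[->//|/IH->]; rewrite orbT.
Qed.

Lemma greedy_sorted s : {in s, forall x, U x0 < L x}%O ->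
  sorted (fun x y => U x < L y)%O (greedy s).
Proof.
elim/last_ind: s => // s x IH ltx0; rewrite greedy_rcons /greedy_step.
have {}IH : sorted (fun x y => U x < L y)%O (greedy s).
  by apply: IH => y ys; apply: ltx0; rewrite mem_rcons inE ys orbT.
case: ifP => //; case: (greedy s) IH => //= y g.
by rewrite rcons_path => -> ->.
Qed.

Lemma greedy_hits s : {in s, forall x, U x0 < L x}%O ->
    {in s, forall x, L x <= U x}%O -> sorted (fun x y => U x <= U y)%O s ->
  {in s, forall x, exists2 y, y \in greedy s & (L x <= U y <= U x)%O}.
Proof.
elim/last_ind: s => // s x IH ltx0 leLU srt.
have sub y : y \in s -> y \in rcons s x by rewrite mem_rcons inE orbC => ->.
have srt_s : sorted (fun x y => U x <= U y)%O s.
  by move: srt; rewrite -cats1 => /cat_sorted2[].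
have lex : {in s, forall y, U y <= U x}%O.
  have tr : transitive (fun x y => U x <= U y)%O.
    by move=> ? ? ?; apply: le_trans.
  move: srt; rewrite (sorted_pairwise tr) pairwise_rcons => /andP[/allP + _].
  by move=> H y /H.
move=> y; rewrite mem_rcons inE greedy_rcons => /orP[/eqP->|ys].
  (* A kept [x] hits itself. If [x] is rejected, the last output [z] has [L x <= U z], and
     [U z <= U x] because the list is sorted by [U]; this [z] cannot be the default [x0]. *)
  rewrite /greedy_step; case: ltP => lt_x.
    exists x; first by rewrite mem_rcons inE eqxx.
    by rewrite lexx leLU // mem_rcons inE eqxx.
  case E: (greedy s) lt_x => [|z g] /= lt_x.
    by move: (ltx0 x); rewrite mem_rcons inE eqxx ltNge lt_x => /(_ isT).
  exists (last z g); first by rewrite mem_last.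
  by rewrite lt_x lex // greedy_sub // E mem_last.
have [||z zg Hz] := IH _ _ srt_s y ys.
- by move=> z /sub/ltx0.
- by move=> z /sub/leLU.
- exists z => //; rewrite /greedy_step; case: ifP => // _.
  by rewrite mem_rcons inE zg orbT.
Qed.

(** Send each kept interval to the first member of [keys] that stabs it. Kept intervals are disjoint
    and increasing, so this map is strictly increasing, hence injective. *)
Lemma size_greedy s (keys : seq K) : {in s, forall x, U x0 < L x}%O ->
    {in s, forall x, exists2 k, k \in keys & (L x <= k <= U x)%O} ->
  (size (greedy s) <= size keys)%N.
Proof.
move=> ltx0 stab; pose stabs x k := (L x <= k <= U x)%O.
pose f x := nth (L x0) keys (find (stabs x) keys).
have fP x : x \in greedy s -> f x \in keys /\ stabs x (f x).
  move=> /greedy_sub/stab[k kk Hk].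
  have hask : has (stabs x) keys by apply/hasP; exists k.
  by split; [rewrite mem_nth // -has_find | apply: nth_find].
rewrite -(size_map f); apply: uniq_leq_size; last first.
  by move=> _ /mapP[x /fP[fk _] ->].
apply/lt_sorted_uniq; rewrite sorted_map.
apply: (sub_in_sorted (P := mem (greedy s))) (greedy_sorted ltx0); last exact/allP.
move=> x y /fP[_ /andP[_ fx]] /fP[_ /andP[fy _]] xy /=.
exact: le_lt_trans fx (lt_le_trans xy fy).
Qed.
End Greedy.

(** * Keys of segments *)

Section Keys.
Variable R : realType.
Implicit Types (s : segment R) (p h d : point R).

Definition key := seqlexi R.

(* By the convention x / 0 = 0, the pair (dirV s, dirM s) is (0, 0) if s is
   vertical and (1, slope) otherwise. *)
Definition dirV s : R := (s.2.1 - s.1.1) / (s.2.1 - s.1.1).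
Definition dirM s : R := (s.2.2 - s.1.2) / (s.2.1 - s.1.1).
(** With first endpoint (ax, ay) and slope m, this is [ay - m * ax] off the vertical case and [ax]
    in it. *)
Definition icept s : R := dirV s * s.1.2 + (1 - dirV s - dirM s) * s.1.1.
(** The abscissa, or the ordinate if [s] is vertical: a coordinate that is injective on the line of
    [s]. *)
Definition par s p : R := dirV s * p.1 + (1 - dirV s) * p.2.

Definition swapped s : bool := par s s.2 < par s s.1.
Definition hi_end s : point R := if swapped s then s.1 else s.2.
Definition lo_end s : point R := if swapped s then s.2 else s.1.
Definition hi_key s : key := [:: dirV s; dirM s; icept s; par s (hi_end s)].
Definition lo_key s : key := [:: dirV s; dirM s; icept s; par s (lo_end s)].

(* The common key of the degenerate interval {h} on the line of direction d. *)
Definition point_key d h : key :=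
  if d.1 == 0 then [:: 0; 0; h.1; h.2]
  else [:: 1; d.2 / d.1; h.2 - d.2 / d.1 * h.1; h.1].

Lemma lexi4 (a b c x y : R) :
  ([:: a; b; c; x] <= [:: a; b; c; y] :> seqlexi R)%O = (x <= y).
Proof. by rewrite !Order.SeqLexiOrder.lexi_cons !lexx /= implybT andbT. Qed.

Lemma par_lo_hi s : par s (lo_end s) <= par s (hi_end s).
Proof.
by rewrite /lo_end /hi_end /swapped; case: ltP => // /ltW.
Qed.

Lemma lo_hi_key s : (lo_key s <= hi_key s)%O.
Proof. by rewrite lexi4 par_lo_hi. Qed.

Lemma dirV_ge0 s : 0 <= dirV s.
Proof.
rewrite /dirV; have [->|nz] := eqVneq (s.2.1 - s.1.1) 0; first by rewrite mul0r.
by rewrite divff.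
Qed.

Lemma between (a b x : R) : a != b ->
  (if b < a then b else a) <= x -> x <= (if b < a then a else b) ->
  exists t, 0 <= t /\ t <= 1 /\ x = (1 - t) * a + t * b.
Proof.
move=> nab; have nz : b - a != 0 by rewrite subr_eq0 eq_sym.
case: ltP => ab le1 le2; exists ((x - a) / (b - a)).
  have neg : b - a < 0 by lra.
  by rewrite ler_ndivlMr // ler_ndivrMr //; split; [lra|split; [lra|field]].
have pos : 0 < b - a by rewrite lt0r nz; lra.
by rewrite ler_pdivlMr // ler_pdivrMr //; split; [lra|split; [lra|field]].
Qed.

Lemma par_between s h (x := par s h) : on_seg h s ->
  par s (lo_end s) <= x <= par s (hi_end s).
Proof.
move=> [t [t0 [t1 hE]]]; have -> : x = (1 - t) * par s s.1 + t * par s s.2.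
  by rewrite /x hE /par /=; ring.
have t1' : 0 <= 1 - t by rewrite subr_ge0.
rewrite /lo_end /hi_end /swapped; apply/andP.
case: ltP; move: (par s s.1) (par s s.2) => a b ab.
  have ab' : 0 <= a - b by rewrite subr_ge0 ltW.
  by have := mulr_ge0 t0 ab'; have := mulr_ge0 t1' ab'; split; lra.
have ab' : 0 <= b - a by rewrite subr_ge0.
by have := mulr_ge0 t0 ab'; have := mulr_ge0 t1' ab'; split; lra.
Qed.

(** The line through [h] of direction [d] is the line of [s], so [point_key d h] differs from the
    keys of [s] only in its last entry [par s h]. *)
Lemma point_key_between s d h : nondeg s -> d != (0, 0) -> has_dir s d ->
  on_seg h s -> (lo_key s <= point_key d h <= hi_key s)%O.
Proof.
move=> snd dnz sd hs; suff -> : point_key d h =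
    [:: dirV s; dirM s; icept s; par s h].
  by rewrite !lexi4 par_between.
case: hs => [t [_ [_ ->]]] {h}; move: snd dnz sd.
case: s => [[ax ay] [bx by_]]; case: d => [dx dy].
rewrite /nondeg /has_dir /point_key /icept /par /dirV /dirM /= !xpair_eqE !negb_and.
move=> snd dnz sd; case: eqVneq => [dx0|dxn0].
  have e : bx - ax = 0.
    apply/eqP; rewrite dx0 eqxx /= in dnz.
    by move: sd; rewrite dx0 mulr0 subr0 => /eqP; rewrite mulf_eq0 (negbTE dnz) orbF.
  rewrite e invr0 !mulr0; have -> : bx = ax by lra.
  by congr [:: _; _; _; _]; ring.
(* For a direction that is not vertical, equal abscissas would force equal ordinates, hence a
   degenerate segment. *)
have e : bx - ax != 0.
  apply/negP => /eqP e; move: sd; rewrite e mul0r sub0r => /eqP.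
  rewrite oppr_eq0 mulf_eq0 (negbTE dxn0) orbF => /eqP e2.
  by case/orP: snd => /negP[]; apply/eqP; lra.
have m : dy / dx = (by_ - ay) / (bx - ax).
  by apply/eqP; rewrite eqr_div //; apply/eqP; lra.
rewrite m divff //; congr [:: _; _; _; _]; last by ring.
by field.
Qed.

Lemma hi_end_on_seg s s' : nondeg s -> nondeg s' ->
  (lo_key s <= hi_key s' <= hi_key s)%O -> on_seg (hi_end s') s.
Proof.
move=> snd snd' /andP[le1 le2].
have [eV eM eC /andP[le_lo le_hi]] : [/\ dirV s' = dirV s, dirM s' = dirM s,
    icept s' = icept s &
    par s (lo_end s) <= par s' (hi_end s') <= par s (hi_end s)].
  move: le1 le2; rewrite !Order.SeqLexiOrder.lexi_cons.
  move: (par s _) (par s _) (par s' _) => l h x.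
  (* Both keys of [s] start alike, so the two leading inequalities are opposite, and each one
     unlocks the comparison of the tails in the other hypothesis. *)
  move=> /andP[a1 /implyP b1] /andP[a2 /implyP b2].
  move: (b1 a2) (b2 a1) => /andP[a3 /implyP b3] /andP[a4 /implyP b4].
  move: (b3 a4) (b4 a3) => /andP[a5 /implyP b5] /andP[a6 /implyP b6].
  move: (b5 a6) (b6 a5) => /andP[-> _] /andP[-> _].
  by split=> //; apply: le_anti; rewrite ?a1 ?a2 ?a3 ?a4 ?a5 ?a6.
(* An upper endpoint can be recovered from its key alone, so [hi_end s'] can be expressed through
   the line of [s]. *)
have lineE z w : w = par z (hi_end z) -> nondeg z ->
    hi_end z = if dirV z == 0 then (icept z, w) else (w, dirM z * w + icept z).
  move=> -> {le1 le2 le_lo le_hi w}; case: z => [[ax ay] [bx by_]].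
  rewrite /nondeg /hi_end /= xpair_eqE negb_and; move: (swapped _).
  rewrite /icept /par /dirV /dirM /=.
  have [e|e] := eqVneq (bx - ax) 0.
    rewrite e invr0 !mulr0 eqxx => b _; have -> : bx = ax by lra.
    by case: b => /=; congr pair; ring.
  rewrite divff // oner_eq0 => b _.
  by case: b => /=; congr pair; field.
rewrite (lineE _ _ erefl snd') eV eM eC; move: (par s' _) le_lo le_hi => x.
rewrite /lo_end /hi_end.
case: s snd {le1 le2 eV eM eC} => [[ax ay] [bx by_]].
rewrite /swapped /nondeg /icept /par /dirV /dirM /on_seg /= xpair_eqE negb_and.
have [e|e] := eqVneq (bx - ax) 0.
  rewrite e invr0 !mulr0 eqxx !mul0r !subr0 !add0r !mul1r.
  have -> : bx = ax by lra.
  rewrite eqxx /= => nab le1 le2.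
  have [t [t0 [t1 xE]]] : exists t, 0 <= t /\ t <= 1 /\ x = (1 - t) * ay + t * by_.
    by apply: between nab _ _; [move: le1|move: le2]; case: ifP.
  by exists t; do 2!split=> //; rewrite -xE; congr pair; ring.
rewrite divff // oner_eq0 subrr !mul0r !addr0 !mul1r => _ le1 le2.
have nab : ax != bx by rewrite eq_sym -subr_eq0.
have [t [t0 [t1 xE]]] : exists t, 0 <= t /\ t <= 1 /\ x = (1 - t) * ax + t * bx.
  by apply: between nab _ _; [move: le1|move: le2]; case: ifP.
exists t; do 2!split=> //; rewrite -xE; congr pair.
by rewrite xE; field.
Qed.
End Keys.

(** * The program *)

Section Upd.
Variables (T : Type) (f : int -> T).

Lemma upd_eq a v b : b = a -> upd f a v b = v.
Proof. by move=> ->; rewrite /upd eqxx. Qed.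

Lemma upd_neq a v b : b != a -> upd f a v b = f b.
Proof. by rewrite /upd => /negbTE ->. Qed.
End Upd.

#[local] Opaque upd.

(* Records of 7 reals (v, m, c, r, l and the upper endpoint) live at the
   addresses ptr i = - 40 - 8 i of the real memory; the record at - 32 is a
   sentinel with v = -1, below all keys.  The cells x1, ..., x11 are real
   registers.  Integer cells below 64 are registers; the pointer arrays being
   merged start at the addresses held in rA (source) and rB (target). *)
Notation rN := (Posz 0).
Notation rOne := (Posz 1).
Notation rZ := (Posz 2).
Notation rA := (Posz 3).
Notation rB := (Posz 4).
Notation rW := (Posz 5).
Notation rW2 := (Posz 6).
Notation rLo := (Posz 7).
Notation rMid := (Posz 8).
Notation rHi := (Posz 9).
Notation rI := (Posz 10).
Notation rJ := (Posz 11).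
Notation rK := (Posz 12).
Notation rP := (Posz 13).
Notation rQ := (Posz 14).
Notation rT := (Posz 15).
Notation rF := (Posz 16).
Notation rC := (Posz 17).
Notation rS := (Posz 18).

Notation x1 := (Negz 0).
Notation x2 := (Negz 1).
Notation x3 := (Negz 2).
Notation x4 := (Negz 3).
Notation x5 := (Negz 4).
Notation x6 := (Negz 5).
Notation x7 := (Negz 6).
Notation x8 := (Negz 7).
Notation x9 := (Negz 8).
Notation x10 := (Negz 9).
Notation x11 := (Negz 10).

(* Sets rF to 1 if the record at rQ is below the record at rP, else to 0; field
   f of the former is compared with field g of the latter. *)
Fixpoint lexcmp (fs : seq (int * int)) : cmd :=
  match fs with
  | [::] => Do (IConst rF 0)
  | (f, g) :: fs' =>
      Do (IConst rT f);; Do (IAdd rT rQ rT);; Do (RLoad x1 rT);;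
      Do (IConst rT g);; Do (IAdd rT rP rT);; Do (RLoad x2 rT);;
      IfR x1 x2 (Do (IConst rF 1)) (IfR x2 x1 (Do (IConst rF 0)) (lexcmp fs'))
  end.

Ltac look :=
  repeat match goal with
  | |- context [upd ?f ?a ?v ?b] =>
      first [ rewrite (@upd_neq _ f a v b isT)
            | rewrite (@upd_eq _ f a v b erefl)
            | rewrite (@upd_eq _ f a v b); [|lia]
            | rewrite (@upd_neq _ f a v b); [|lia] ]
  end.

Ltac sx :=
  (first [ apply: wp_do_seq; first exact: isT
         | apply: wp_do; first exact: isT ]);
  lazy beta iota delta [exec_int exec_real]; look.

Section Programs.
Variable R : realType.
Implicit Types (M : int -> int) (X : int -> R).

(** The sentinel and the records lie in this range, the real registers (-1 to -11) and the output
    cells outside it. Once built, the records are read off a frozen memory [X0], with which all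
    later memories agree here. *)
Definition agree X X' := forall a, a <= - 20%:Z -> X a = X' a.
Definition same_out X X' := forall a, 0 <= a -> X a = X' a.

Lemma wp_lexcmp fs Q M X X0 (k : nat) :
  (forall f, f \in fs -> M rQ + f.1 <= - 20%:Z /\ M rP + f.2 <= - 20%:Z) ->
  agree X X0 -> (10 * size fs + 1 <= k)%N ->
  (forall M' X',
     M' rF = (([seq X0 (M rQ + f.1) | f <- fs] : seqlexi R)
              < [seq X0 (M rP + f.2) | f <- fs])%O%:Z ->
     (forall a, a != rT -> a != rF -> M' a = M a) ->
     agree X' X0 -> same_out X' X -> Q M' X') ->
  wp (lexcmp fs) k (fun _ => Q) M X.
Proof.
elim: fs M X k => [|[f g] fs IH] M X k Hfs XX0 le_k HQ.
  apply: wp_le le_k _; rewrite [lexcmp _]/=; sx.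
  by apply: HQ; [look|move=> a aT aF; look|exact: XX0|].
have [Hf Hg] : M rQ + f <= - 20%:Z /\ M rP + g <= - 20%:Z.
  by apply: (Hfs (f, g)); rewrite inE eqxx.
(* One field costs six instructions for the loads and at most 2 for each of the two tests. *)
apply: (@wp_le _ _ (10 + (10 * size fs + 1))); first by move: le_k => /=; lia.
rewrite [lexcmp _]/=; do 6!sx.
rewrite (XX0 _ Hf) (XX0 _ Hg).
have XX0' v1 v2 : agree (upd (upd X x1 v1) x2 v2) X0.
  by move=> a a20; look; apply: XX0.
have out' v1 v2 : same_out (upd (upd X x1 v1) x2 v2) X.
  by move=> a a0; look.
apply: wp_ifR; look => lt1.
  sx; apply: HQ; [look|move=> a aT aF; look|exact: XX0'|exact: out'] => //.
  by rewrite /= Order.SeqLexiOrder.ltxi_cons (ltW lt1) leNgt lt1.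
apply: wp_ifR; look => lt2.
  sx; apply: HQ; [look|move=> a aT aF; look|exact: XX0'|exact: out'] => //.
  by rewrite /= Order.SeqLexiOrder.ltxi_cons (leNgt (X0 _)) lt2.
have e12 : X0 (M rQ + f) = X0 (M rP + g) by apply: le_anti; rewrite !leNgt lt1 lt2.
apply: (IH _ _ (10 * size fs + 1)%N); [|exact: XX0'|exact: leqnn|].
  by move=> fg fgs; look; apply: Hfs; rewrite inE fgs orbT.
move=> M' X' F Fr XX0'' out''; apply: HQ => //.
- rewrite F; look; congr Posz; congr nat_of_bool.
  by rewrite /= Order.SeqLexiOrder.ltxi_cons e12 lexx.
- by move=> a aT aF; rewrite Fr //; look.
- by move=> a a0; rewrite out'' // out'.
Qed.

(** Registers are numbered so that what a procedure preserves is an initial segment: 10 of them in a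
    merge loop, 7 in a pass, 3 in the whole sort, which swaps [rA] and [rB]. *)
Definition same (k : nat) M M' := forall a, 0 <= a < k%:Z -> M a = M' a.

Lemma same_trans k M1 M2 M3 : same k M1 M2 -> same k M2 M3 -> same k M1 M3.
Proof. by move=> h1 h2 a ak; rewrite h1 ?h2. Qed.

Definition arr M b (s : seq int) := forall i, (i < size s)%N -> M (b + i%:Z) = nth 0 s i.

Definition rec_key X (p : int) : key R := [:: X (p + 0); X (p + 1); X (p + 2); X (p + 3)].

End Programs.

(** * Bottom-up merge sort of the pointer array *)

Definition key_fields : seq (int * int) := [:: (0, 0); (1, 1); (2, 2); (3, 3)].

(** [rF = 1] selects the right run. The comparison is strict, so ties go to the left run, as in
    [merge]. *)
Definition merge_body : cmd :=
  IfI rI rMid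
    (IfI rJ rHi
      (Do (IAdd rT rA rI);; Do (ILoad rP rT);; Do (IAdd rT rA rJ);; Do (ILoad rQ rT);;
       lexcmp key_fields)
      (Do (IConst rF 0)))
    (Do (IConst rF 1));;
  IfI rZ rF
    (Do (IAdd rT rA rJ);; Do (IAdd rJ rJ rOne))
    (Do (IAdd rT rA rI);; Do (IAdd rI rI rOne));;
  Do (ILoad rP rT);; Do (IAdd rT rB rK);; Do (IStore rT rP);; Do (IAdd rK rK rOne).

Definition merge_pass : cmd :=
  Do (IAdd rMid rLo rW);; IfI rN rMid (Do (IAdd rMid rN rZ)) Skip;;
  Do (IAdd rHi rLo rW2);; IfI rN rHi (Do (IAdd rHi rN rZ)) Skip;;
  Do (IAdd rI rLo rZ);; Do (IAdd rJ rMid rZ);; Do (IAdd rK rLo rZ);;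
  While rK rHi merge_body;;
  Do (IAdd rLo rLo rW2).

Definition merge_sort : cmd :=
  Do (IConst rW 1);;
  While rW rN (
    Do (IConst rLo 0);; Do (IAdd rW2 rW rW);;
    While rLo rN merge_pass;;
    Do (IAdd rT rA rZ);; Do (IAdd rA rB rZ);; Do (IAdd rB rT rZ);;
    Do (IAdd rW rW2 rZ)).

Section MergeBody.
Variables (R : realType) (X0 : int -> R) (n : nat).
Implicit Types (M : int -> int) (X : int -> R) (s z : seq int).

Definition rec_le : rel int := fun p q => (rec_key X0 p <= rec_key X0 q)%O.

(** Either array may come first, since the two exchange roles after every round; 64 keeps both off
    the registers. *)
Definition apart (bA bB : int) :=
  64 <= bA /\ 64 <= bB /\ (bA + n%:Z <= bB \/ bB + n%:Z <= bA).

Definition pointers s := size s = n /\ forall p, p \in s -> p <= - 32%:Z.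

Lemma merge_nil s : merge rec_le s [::] = s.
Proof. by case: s. Qed.

Definition take_left s mid hi i j : bool :=
  (i < mid)%N && ((j < hi)%N ==> rec_le (nth 0 s i) (nth 0 s j)).

(** What is written followed by the merge of what is unread stays constant. [z] includes the blocks
    finished earlier in the pass, so its size is the absolute index held in [rK]. *)
Lemma wp_merge_body s z M X (bA bB : int) (mid hi i j : nat) :
  pointers s -> apart bA bB ->
  M rOne = 1 -> M rZ = 0 -> M rA = bA -> M rB = bB ->
  M rMid = mid%:Z -> M rHi = hi%:Z -> M rI = i%:Z -> M rJ = j%:Z ->
  M rK = (size z)%:Z ->
  (i <= mid)%N -> (mid <= j)%N -> (j <= hi)%N -> (hi <= n)%N ->
  (size z + mid = i + j)%N -> (size z < hi)%N ->
  arr M bA s -> arr M bB z -> agree X X0 ->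
  wp merge_body 70 (fun _ M' X' => exists i' j' z',
    [/\ (i' <= mid)%N, (mid <= j')%N & (j' <= hi)%N] /\
    [/\ (size z' + mid = i' + j')%N, size z' = (size z).+1,
       z' ++ merge rec_le (drop i' (take mid s)) (drop j' (take hi s)) =
       z ++ merge rec_le (drop i (take mid s)) (drop j (take hi s)) & agree X' X0] /\
    [/\ M' rI = i'%:Z, M' rJ = j'%:Z, M' rK = (size z')%:Z & same 10 M' M] /\
    [/\ arr M' bA s & arr M' bB z']) M X.
Proof.
move=> [sz ptr] [bA64 [bB64 AB]] hOne hZ hA hB hMid hHi hI hJ hK.
move=> le_i le_mj le_j le_hi ijk lt_k arrA arrB XX0.
apply: (@wp_seq_mid _ (fun M' X' => [/\ M' rF = (~~ take_left s mid hi i j)%:Z,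
  forall a, a != rF -> a != rT -> a != rP -> a != rQ -> M' a = M a & agree X' X0]) _ _ 55 15).
- by [].
- apply: wp_ifI; rewrite hI hMid => lt_i.
    apply: wp_ifI; rewrite hJ hHi => lt_j.
      have [ei ej] : M (bA + i%:Z) = nth 0 s i /\ M (bA + j%:Z) = nth 0 s j.
        by split; rewrite arrA // sz; lia.
      do 4!(sx; rewrite ?hA ?hI ?hJ ?ei ?ej).
      apply: (@wp_lexcmp _ _ _ _ _ X0) => //.
        move=> [f g] fg; look; rewrite /=.
        have := ptr (nth 0 s i) (mem_nth _ _); have := ptr (nth 0 s j) (mem_nth _ _).
        rewrite sz; move: fg; rewrite !inE !xpair_eqE /=.
        by lia.
      move=> M' X'; look => F Fr XX0' _; split=> //.
        have [il jl] : (i < mid)%N /\ (j < hi)%N by split; lia.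
        by rewrite F /take_left il jl /rec_le /= -ltNge.
      by move=> a aF aT aP aQ; rewrite Fr //; look.
    sx; split=> //; look.
      have [il jl] : (i < mid)%N /\ (j < hi)%N = false by split; lia.
      by rewrite /take_left il jl.
    by move=> a aF aT aP aQ; look.
  sx; split=> //; look.
    have il : (i < mid)%N = false by lia.
    by rewrite /take_left il.
  by move=> a aF aT aP aQ; look.
move=> {XX0}M1 X1 [F Fr XX0].
have sz_mid : size (take mid s) = mid by rewrite size_takel // sz; lia.
have sz_hi : size (take hi s) = hi by rewrite size_takel // sz; lia.
have [ltl|gel] := boolP (take_left s mid hi i j); rewrite ?ltl ?gel /= in F.
  have [lt_i cmp] := andP ltl.
  apply: wp_seq; apply: wp_ifI; rewrite F Fr // hZ => // _.
  have ei : M1 (bA + i%:Z) = nth 0 s i by rewrite Fr ?arrA //; lia.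
  do 6!(sx; rewrite ?(Fr rA) ?(Fr rI) ?(Fr rOne) ?(Fr rB) ?(Fr rK) ?hA ?hI ?hOne ?hB ?hK ?ei //).
  exists i.+1, j, (rcons z (nth 0 s i)); rewrite !size_rcons.
  split; first by split=> //; lia.
  split; [split=> // |split; split]; look => //.
  - by lia.
  - rewrite cat_rcons; congr cat.
    rewrite [in RHS](drop_nth 0) ?sz_mid // nth_take //.
    have [lt_j|ge_j] := ltnP j hi; last first.
      by rewrite [drop j _]drop_oversize ?sz_hi // !merge_nil.
    rewrite [drop j _](drop_nth 0) ?sz_hi // nth_take //=.
    by move: cmp; rewrite lt_j /= => ->.
  - by lia.
  - by rewrite Fr.
  - by lia.
  - by move=> a a10; look; rewrite Fr //; lia.
  - by move=> a as_; rewrite sz in as_; look; rewrite Fr ?arrA ?sz //; lia.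
  - move=> a; rewrite size_rcons ltnS leq_eqVlt nth_rcons => /orP[/eqP->|la].
      by rewrite ltnn eqxx; look.
    by rewrite la; look; rewrite Fr ?arrB //; lia.
have lt_j : (j < hi)%N.
  move: gel; rewrite /take_left; have [//|jh] := ltnP j hi.
  by rewrite andbT => il; lia.
have cmp : (i < mid)%N -> rec_le (nth 0 s i) (nth 0 s j) = false.
  by move=> il; apply/negbTE; move: gel; rewrite /take_left lt_j il.
apply: wp_seq; apply: wp_ifI; rewrite F Fr // hZ => // _.
have ej : M1 (bA + j%:Z) = nth 0 s j by rewrite Fr ?arrA //; lia.
do 6!(sx; rewrite ?(Fr rA) ?(Fr rJ) ?(Fr rOne) ?(Fr rB) ?(Fr rK) ?hA ?hJ ?hOne ?hB ?hK ?ej //).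
exists i, j.+1, (rcons z (nth 0 s j)); rewrite !size_rcons.
split; first by split=> //; lia.
split; [split=> // |split; split]; look => //.
- by lia.
- rewrite cat_rcons; congr cat.
  rewrite [drop j _ in RHS](drop_nth 0) ?sz_hi // nth_take //.
  have [lt_i|ge_i] := ltnP i mid; last first.
    by rewrite [drop i _]drop_oversize ?sz_mid.
  rewrite [drop i _](drop_nth 0) ?sz_mid // nth_take //= cmp //.
- by rewrite Fr.
- by lia.
- by lia.
- by move=> a a10; look; rewrite Fr //; lia.
- by move=> a as_; rewrite sz in as_; look; rewrite Fr ?arrA ?sz //; lia.
- move=> a; rewrite size_rcons ltnS leq_eqVlt nth_rcons => /orP[/eqP->|la].
    by rewrite ltnn eqxx; look.
  by rewrite la; look; rewrite Fr ?arrB //; lia.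
Qed.
End MergeBody.

(** * Sorted blocks of a list and their pairwise merging *)

Section Runs.
Variables (T : eqType) (le : rel T).
Hypothesis le_total : total le.
Implicit Types s z : seq T.

(* s is a concatenation of sorted blocks of length w (the last may be shorter). *)
Definition runs w s := forall i, sorted le (take w (drop (i * w)%N s)).

Lemma runs1 s : runs 1 s.
Proof. by move=> i; case: (drop _ s) => //= x t; rewrite take0. Qed.

Lemma runs_sorted w s : (size s <= w)%N -> runs w s -> sorted le s.
Proof. by move=> sw /(_ 0%N); rewrite mul0n drop0 take_oversize. Qed.

Lemma runs_cat w e s z : size s = (e * w)%N -> runs w s ->
  sorted le z -> (size z <= w)%N -> runs w (s ++ z).
Proof.
move=> sz rs sortz zw i; have [lt_ie|le_ei] := ltnP i e.
  have le1 : (i.+1 * w <= size s)%N by rewrite sz leq_mul2r lt_ie orbT.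
  rewrite mulSn addnC in le1.
  rewrite drop_cat; case: ltnP => [lt_i|ge_i].
    by rewrite takel_cat // size_drop; lia.
  (* Block [i] starts at or after the end of [s] and yet ends within [s], so blocks are empty. *)
  have w0 : w = 0%N by lia.
  by rewrite w0 take0.
rewrite drop_cat sz ltnNge leq_mul2r le_ei orbT /=.
rewrite take_oversize; last by rewrite size_drop; lia.
by apply: drop_sorted.
Qed.

Lemma take_drop_minn s w lo : take w (drop lo s) = drop lo (take (minn (lo + w) (size s)) s).
Proof.
rewrite take_drop addnC; congr drop; case: leqP => // h.
by rewrite take_size take_oversize // ltnW.
Qed.

(** Block [e] of double width comes from the blocks [e + e] and [(e + e).+1] of width [w]. The
    minima cut blocks at the end of the list, where the second one may be empty. *)
Lemma runs_merge w e s out (lo := (e * (w + w))%N)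
    (mid := minn (lo + w) (size s)) (hi := minn (lo + (w + w)) (size s))
    (out' := out ++ merge le (drop lo (take mid s)) (drop mid (take hi s))) :
  size out = lo -> (lo <= size s)%N -> runs w s -> runs (w + w) out ->
  perm_eq out (take lo s) ->
  runs (w + w) out' /\ perm_eq out' (take hi s).
Proof.
move=> szo le_lo rs ro po.
have lem : (lo <= mid)%N by rewrite /mid; lia.
have leh : (mid <= hi)%N by rewrite /mid /hi; lia.
have leS : (hi <= size s)%N by rewrite /hi; lia.
split; last first.
  rewrite /out' perm_sym; apply: (@perm_trans _ (take lo s ++ (drop lo (take mid s) ++ drop mid (take hi s)))).
    have e1 : take mid (take hi s) = take mid s by rewrite take_takel.
    have e2 : take lo (take mid s) = take lo s by rewrite take_takel.
    by rewrite -{1}[take hi s](cat_take_drop mid) e1 -{1}[take mid s](cat_take_drop lo) e2 catA.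
  by apply: perm_cat; rewrite perm_sym // perm_merge.
apply: (runs_cat szo) => //.
  apply: merge_sorted => //.
    rewrite -take_drop_minn; have := rs (e + e)%N.
    by rewrite /lo; congr (sorted le (take w (drop _ s))); lia.
  have [lt|ge] := leqP (lo + w) (size s); last first.
    by rewrite drop_oversize // size_take; case: ifP; rewrite /mid /hi; lia.
  have -> : mid = (lo + w)%N by rewrite /mid; lia.
  have -> : hi = minn (lo + w + w) (size s) by rewrite /hi addnA.
  rewrite -take_drop_minn; have := rs (e + e).+1.
  by rewrite /lo; congr (sorted le (take w (drop _ s))); lia.
have leH : (hi <= lo + (w + w))%N by rewrite geq_minl.
rewrite size_merge size_cat !size_drop (size_takel (leq_trans leh leS)) (size_takel leS).
by clearbody hi mid; lia.
Qed.
End Runs.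

Section MergePass.
Variables (R : realType) (X0 : int -> R) (n : nat).
Implicit Types (M : int -> int) (X : int -> R) (s z : seq int).

Lemma wp_merge_loop s out M X (bA bB : int) (lo mid hi : nat) :
  pointers n s -> apart n bA bB ->
  M rOne = 1 -> M rZ = 0 -> M rA = bA -> M rB = bB ->
  M rMid = mid%:Z -> M rHi = hi%:Z -> M rI = lo%:Z -> M rJ = mid%:Z ->
  M rK = lo%:Z -> size out = lo ->
  (lo <= mid)%N -> (mid <= hi)%N -> (hi <= n)%N ->
  arr M bA s -> arr M bB out -> agree X X0 ->
  wp (While rK rHi merge_body) (72 * (hi - lo) + 2) (fun _ M' X' =>
    [/\ agree X' X0, same 10 M' M, arr M' bA s &
        arr M' bB (out ++ merge (rec_le X0) (drop lo (take mid s)) (drop mid (take hi s)))])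
   M X.
Proof.
move=> ptr ap hOne hZ hA hB hMid hHi hI hJ hK szo le_lo le_mid le_hi arrA arrB XX0.
have sz : size s = n by case: ptr.
pose I (m : nat) M' X' := exists (i j : nat) z, [/\ (i <= mid)%N, (mid <= j)%N & (j <= hi)%N] /\
    [/\ (size z + mid = i + j)%N, (72 * (hi - size z) + 2 <= m)%N,
       z ++ merge (rec_le X0) (drop i (take mid s)) (drop j (take hi s)) =
       out ++ merge (rec_le X0) (drop lo (take mid s)) (drop mid (take hi s)) & agree X' X0] /\
    [/\ M' rI = i%:Z, M' rJ = j%:Z, M' rK = (size z)%:Z & same 10 M' M] /\
    [/\ arr M' bA s & arr M' bB z].
apply: (@wp_while _ I) => [m M1 X1|m M1 X1|]; last 1 first.
- exists lo, mid, out; rewrite szo; do !split=> //; lia.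
- case=> i [j [z [[le_i le_mj le_j] [[ijz le_m zE XX1] [[hI1 hJ1 hK1 sm] [aA aB]]]]]].
  rewrite hK1 sm // hHi => lt; exists 70, (72 * (hi - (size z).+1) + 2)%N.
  split; first lia.
  apply: wp_post.
    apply: (@wp_merge_body _ X0 n s z M1 X1 bA bB mid hi i j) => //; rewrite ?sm //; lia.
  move=> _ M2 X2 [i' [j' [z' [[le_i' le_mj' le_j'] [[ijz' szz' zE' XX2] [[hI2 hJ2 hK2 sm2] [aA2 aB2]]]]]]].
  exists i', j', z'; split; first by split.
  split; first by rewrite zE' -szz'; split.
  by split; [split=> //; apply: same_trans sm2 sm | split].
case=> i [j [z [[le_i le_mj le_j] [[ijz le_m zE XX1] [[hI1 hJ1 hK1 sm] [aA aB]]]]]].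
rewrite hK1 sm // hHi => ge; have [ei ej] : i = mid /\ j = hi by lia.
split; first lia.
have [szm szh] : size (take mid s) = mid /\ size (take hi s) = hi.
  by rewrite !size_takel // sz; lia.
split=> //; move: zE; rewrite ei ej.
rewrite [drop mid (take mid s)]drop_oversize ?szm // [drop hi _]drop_oversize ?szh //.
by rewrite /= cats0 => <-.
Qed.

Lemma wp_clamp r (v : nat) c k Q M X :
  M rN = n%:Z -> M rZ = 0 -> M r = v%:Z -> r != rN ->
  (forall M', M' r = (minn v n)%:Z -> (forall a, a != r -> M' a = M a) ->
     wp c k (fun _ => Q) M' X) ->
  wp (IfI rN r (Do (IAdd r rN rZ)) Skip;; c) (3 + k) (fun _ => Q) M X.
Proof.
move=> hN hZ hr rN_ H; apply: (@wp_le _ _ k.+1.+2) => //.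
apply: wp_seq; apply: wp_ifI; rewrite hN hr => lt.
  sx; apply: (wp_le (leqnSn k)); apply: H => [|a ar]; last by rewrite upd_neq.
  by rewrite upd_eq // hN hZ; lia.
by apply: wp_skip; apply: (wp_le (leqnSn k)); apply: H => //; rewrite hr; lia.
Qed.

Lemma wp_merge_pass s out w e M X (bA bB : int) (lo := (e * (w + w))%N)
    (mid := minn (lo + w) n) (hi := minn (lo + (w + w)) n) :
  pointers n s -> apart n bA bB -> (lo < n)%N -> (0 < w)%N -> size out = lo ->
  M rN = n%:Z -> M rOne = 1 -> M rZ = 0 -> M rA = bA -> M rB = bB ->
  M rW = w%:Z -> M rW2 = (w + w)%N%:Z -> M rLo = lo%:Z ->
  arr M bA s -> arr M bB out -> agree X X0 ->
  wp merge_pass (72 * (hi - lo) + 20) (fun _ M' X' =>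
    [/\ agree X' X0, same 7 M' M, M' rLo = (e.+1 * (w + w))%N%:Z & arr M' bA s /\
        arr M' bB (out ++ merge (rec_le X0) (drop lo (take mid s)) (drop mid (take hi s)))])
   M X.
Proof.
move=> ptr ap lo_n w0 szo hN hOne hZ hA hB hW hW2 hLo arrA arrB XX0.
have sz : size s = n by case: ptr.
have [bA64 [bB64 _]] := ap.
have [lm mh hn] : [/\ (lo <= mid)%N, (mid <= hi)%N & (hi <= n)%N].
  by rewrite /mid /hi; clearbody lo; split; lia.
have arr_same b M' t : 64 <= b -> (forall a, 64 <= a -> M' a = M a) ->
    arr M b t -> arr M' b t.
  by move=> b64 H Ht i it; rewrite H ?Ht //; lia.
apply: (@wp_le _ _ (1 + (3 + (1 + (3 + (3 + (72 * (hi - lo) + 2 + 1))))))); first by lia.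
sx; rewrite hLo hW; apply: (@wp_clamp _ (lo + w)); [by look|by look|by look|by []|].
rewrite -/mid => M1 hMid Fr1.
sx; rewrite !Fr1 //; look; rewrite hLo hW2.
apply: (@wp_clamp _ (lo + (w + w)));
  [by look; rewrite Fr1 //; look|by look; rewrite Fr1 //; look|by look|by []|].
rewrite -/hi => M2 hHi Fr2.
have Fr a : a != rMid -> a != rHi -> M2 a = M a.
  by move=> a1 a2; rewrite Fr2 //; look; rewrite Fr1 //; look.
have hMid2 : M2 rMid = mid%:Z by rewrite Fr2 //; look.
do 3!(sx; rewrite ?hMid2 ?Fr // ?hLo ?hZ ?addr0).
apply: (@wp_seq_mid _ _ _ _ (72 * (hi - lo) + 2)%N 1); first exact: leqnn.
  apply: (@wp_merge_loop s out _ _ bA bB lo mid hi) => //; look => //; rewrite ?Fr //.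
  - by apply: arr_same arrA => // a a64; look; apply: Fr; lia.
  - by apply: arr_same arrB => // a a64; look; apply: Fr; lia.
move=> M3 X3 [XX3 sm aA aB]; sx; rewrite !sm //; look; rewrite !Fr // hLo hW2.
split=> //; look.
- by move=> a a7; look; rewrite sm; [look; rewrite Fr //; lia|lia].
- by rewrite /lo mulSn; clearbody lo; lia.
have S3 i b : 64 <= b -> upd M3 rLo (lo%:Z + (w + w)%N%:Z) (b + i%:Z) = M3 (b + i%:Z).
  by move=> b64; look.
by split=> i it; rewrite S3 //; [exact: aA|exact: aB].
Qed.

End MergePass.

Section MergeSort.
Variables (R : realType) (X0 : int -> R) (n : nat).
Implicit Types (M : int -> int) (X : int -> R) (s z : seq int).

Lemma rec_le_total : total (rec_le X0).
Proof. by move=> p q; apply: le_total. Qed.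

Lemma wp_merge_passes s w M X (bA bB : int) :
  pointers n s -> apart n bA bB -> (0 < w)%N ->
  M rN = n%:Z -> M rOne = 1 -> M rZ = 0 -> M rA = bA -> M rB = bB ->
  M rW = w%:Z -> M rW2 = (w + w)%N%:Z -> M rLo = 0 ->
  arr M bA s -> agree X X0 -> runs (rec_le X0) w s ->
  wp (While rLo rN merge_pass) (94 * n + 2) (fun _ M' X' => exists s',
    [/\ perm_eq s' s, runs (rec_le X0) (w + w) s', arr M' bB s', agree X' X0 & same 7 M' M])
   M X.
Proof.
move=> ptr ap w0 hN hOne hZ hA hB hW hW2 hLo arrA XX0 rs.
have sz : size s = n by case: ptr.
pose I (m : nat) M' X' := exists (e : nat) out,
  [/\ (94 * (n - e * (w + w)) + 2 <= m)%N, M' rLo = (e * (w + w))%N%:Z,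
    perm_eq out (take (e * (w + w)) s) & runs (rec_le X0) (w + w) out] /\
  [/\ arr M' bA s, arr M' bB out, agree X' X0 & same 7 M' M].
apply: (@wp_while _ I) => [m M1 X1|m M1 X1|]; last 1 first.
- exists 0%N, [::]; split; first by rewrite mul0n subn0 take0.
  by split=> // i.
- case=> e [out [[le_m hLo1 po ro] [aA aB XX1 sm]]].
  rewrite hLo1 sm // hN => lt.
  have szo : size out = (e * (w + w))%N by rewrite (perm_size po) size_takel // sz; lia.
  pose hi := minn (e * (w + w) + (w + w)) n.
  have hiE : hi = minn (e * (w + w) + (w + w)) n by [].
  (* The fixed cost of a block, 20 plus 2 for the loop, is charged to one of its records, and a
     block is nonempty: hence 94 = 72 + 22 per record. After a short last block the truncated
     subtraction gives 0. *)
  exists (72 * (hi - e * (w + w)) + 20)%N, (94 * (n - e.+1 * (w + w)) + 2)%N.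
  split; first by rewrite [(e.+1 * _)%N]mulSn; move: (e * (w + w))%N hiE lt le_m => lo; clearbody hi; lia.
  apply: wp_post.
    by apply: (@wp_merge_pass _ X0 n s out w e _ _ bA bB) => //; rewrite ?sm.
  move=> _ M2 X2 /= [XX2 sm2 hLo2 [aA2 aB2]].
  have [|r2 p2] := runs_merge rec_le_total szo _ rs ro po.
    by rewrite sz; lia.
  rewrite sz in r2 p2; eexists e.+1, _; split; last first.
    by split; [exact: aA2|exact: aB2|exact: XX2|exact: same_trans sm2 sm].
  split=> //; apply: perm_trans p2 _.
  rewrite [(e.+1 * _)%N]mulSn addnC; case: leqP => // ge.
  by rewrite -{1}sz take_size take_oversize // sz ltnW.
case=> e [out [[le_m hLo1 po ro] [aA aB XX1 sm]]].
rewrite hLo1 sm // hN => ge; split; first lia.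
by exists out; split=> //; rewrite take_oversize // in po; rewrite sz; lia.
Qed.

Lemma wp_merge_sort s M X (bA bB : int) :
  pointers n s -> apart n bA bB ->
  M rN = n%:Z -> M rOne = 1 -> M rZ = 0 -> M rA = bA -> M rB = bB ->
  arr M bA s -> agree X X0 ->
  wp merge_sort (100 * (n * up_log 2 n) + 3) (fun _ M' X' => exists s',
    [/\ perm_eq s' s, sorted (rec_le X0) s', agree X' X0 & same 3 M' M] /\
    (64 <= M' rA /\ arr M' (M' rA) s')) M X.
Proof.
move=> ptr ap hN hOne hZ hA hB arrA XX0.
have sz : size s = n by case: ptr.
apply: (@wp_le _ _ (1 + (100 * (n * up_log 2 n) + 2))); first by lia.
sx; pose I (m : nat) M' X' := exists (e : nat) s',
  [/\ (100 * (n * (up_log 2 n - e)) + 2 <= m)%N, M' rW = (2 ^ e)%N%:Z,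
    perm_eq s' s & runs (rec_le X0) (2 ^ e) s'] /\
  [/\ apart n (M' rA) (M' rB), arr M' (M' rA) s', agree X' X0 & same 3 M' M].
have [bA64 _] := ap.
apply: (@wp_while _ I) => [m M1 X1|m M1 X1|]; last 1 first.
- exists 0%N, s; split.
    by rewrite subn0; split=> //; exact: runs1.
  split; look; rewrite ?hA ?hB //.
    by move=> i i_s; look; apply: arrA.
  by move=> a a3; look.
- case=> e [s' [[le_m hW1 ps rs] [ap1 aA XX1 sm]]].
  rewrite hW1 sm // hN => lt.
  have w0 : (0 < 2 ^ e)%N by rewrite expn_gt0.
  have e_lt : (e < up_log 2 n)%N.
    rewrite ltnNge; apply/negP => le_e.
    have := up_logP n (isT : 1 < 2)%N; rewrite -(leq_exp2l _ _ (isT : 1 < 2)%N) in le_e.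
    by move=> h; have := leq_trans h le_e; lia.
  (* With the loop overhead a round costs [94 * n + 10], at most [100 * n] because [2 ^ e < n]
     forces [n >= 2]. *)
  exists (2 + ((94 * n + 2) + 4))%N, (100 * (n * (up_log 2 n - e.+1)) + 2)%N; split.
    rewrite (_ : (up_log 2 n - e = (up_log 2 n - e.+1).+1)%N) in le_m; last lia.
    by rewrite mulnS mulnDr in le_m; lia.
  have ptr' : pointers n s'.
    by case: ptr => _ H; split=> [|p]; rewrite ?(perm_size ps) // (perm_mem ps); apply: H.
  have [bA64' [bB64' ap1']] := ap1.
  do 2!sx; rewrite hW1 -PoszD; apply: (@wp_seq_mid _ _ _ _ (94 * n + 2) 4); first exact: leqnn.
    apply: (@wp_merge_passes s' (2 ^ e) _ _ (M1 rA) (M1 rB)) => //;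
      look => //; rewrite ?(sm rN) ?(sm rOne) ?(sm rZ) //.
    by move=> i i_s; look; apply: aA.
  move=> M2 X2 [s2 [p2 r2 aB2 XX2 sm2]].
  have hA2 : M2 rA = M1 rA by rewrite sm2 //; look.
  have hB2 : M2 rB = M1 rB by rewrite sm2 //; look.
  have hZ2 : M2 rZ = 0 by rewrite sm2 //; look; rewrite sm.
  have hW22 : M2 rW2 = (2 ^ e.+1)%N%:Z by rewrite sm2 //; look; rewrite expnS mul2n addnn.
  do 4!(sx; rewrite ?hA2 ?hB2 ?hZ2 ?hW22 ?addr0).
  exists e.+1, s2; split.
    by split=> //; [exact: perm_trans p2 ps|rewrite expnS mul2n -addnn].
  split; look => //.
  - by split=> //; split=> //; lia.
  - by move=> i i_s; look; apply: aB2.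
  - by move=> a a3; look; rewrite sm2; [look; apply: sm|lia].
case=> e [s' [[le_m hW1 ps rs] [[bA64' _] aA XX1 sm]]].
rewrite hW1 sm // hN => ge; split; first exact: leq_trans (leq_addl _ _) le_m.
exists s'; split=> //; split=> //.
by apply: runs_sorted rs; rewrite (perm_size ps) sz; lia.
Qed.

End MergeSort.

(** * Computing the records from the input *)

Definition load_segment : cmd :=
  Do (RLoad x1 rS);; Do (IAdd rS rS rOne);; Do (RLoad x2 rS);; Do (IAdd rS rS rOne);;
  Do (RLoad x3 rS);; Do (IAdd rS rS rOne);; Do (RLoad x4 rS);; Do (IAdd rS rS rOne);;
  Do (RSub x5 x3 x1);; Do (RSub x6 x4 x2);; Do (RDiv x7 x5 x5);; Do (RDiv x6 x6 x5);;
  Do (RConst x5 1);; Do (RSub x5 x5 x7);;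
  Do (RMul x8 x7 x2);; Do (RSub x9 x5 x6);; Do (RMul x9 x9 x1);; Do (RAdd x8 x8 x9);;
  Do (RMul x9 x7 x1);; Do (RMul x10 x5 x2);; Do (RAdd x9 x9 x10);;
  Do (RMul x10 x7 x3);; Do (RMul x11 x5 x4);; Do (RAdd x10 x10 x11).

Definition store4 (a b c d : int) : cmd :=
  Do (RStore rT a);; Do (IAdd rT rT rOne);; Do (RStore rT b);; Do (IAdd rT rT rOne);;
  Do (RStore rT c);; Do (IAdd rT rT rOne);; Do (RStore rT d).

Definition store_record : cmd :=
  Do (IAdd rT rP rZ);; Do (RStore rT x7);; Do (IAdd rT rT rOne);; Do (RStore rT x6);;
  Do (IAdd rT rT rOne);; Do (RStore rT x8);; Do (IAdd rT rT rOne);;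
  IfR x10 x9 (store4 x9 x10 x1 x2) (store4 x10 x9 x3 x4).

Definition make_record : cmd :=
  load_segment;; store_record;;
  Do (IAdd rT rA rI);; Do (IStore rT rP);; Do (IAdd rI rI rOne);;
  Do (IConst rT 8);; Do (ISub rP rP rT).

Definition make_records : cmd :=
  Do (IConst rOne 1);; Do (IConst rZ 0);; Do (IConst rA 64);; Do (IAdd rB rA rN);;
  Do (IConst rQ (- 32%:Z));; Do (RConst x1 (- 1%:Z));; Do (RStore rQ x1);;
  Do (IConst rI 0);; Do (IConst rS 0);; Do (IConst rP (- 40%:Z));;
  While rI rN make_record.

Definition ptr (i : nat) : int := - 40%:Z - 8%:Z * i%:Z.

(** * From segments to sorted records to output *)

Section Records.
Variable R : realType.
Implicit Types (M : int -> int) (X : int -> R) (s : segment R) (S : seq (segment R)).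

Definition record_at X (p : int) s : Prop :=
  [/\ X (p + 0) = dirV s, X (p + 1) = dirM s, X (p + 2) = icept s &
      X (p + 3) = par s (hi_end s)] /\
  [/\ X (p + 4) = par s (lo_end s), X (p + 5) = (hi_end s).1 & X (p + 6) = (hi_end s).2].

Lemma wp_load_segment M X (i : nat) s : M rOne = 1 -> M rS = (4 * i)%N%:Z ->
  X (4 * i)%N%:Z = s.1.1 -> X (4 * i)%N.+1%:Z = s.1.2 ->
  X (4 * i)%N.+2%:Z = s.2.1 -> X (4 * i)%N.+3%:Z = s.2.2 ->
  wp load_segment 24 (fun _ M' X' =>
    [/\ M' rS = (4 * i.+1)%N%:Z, forall a, a != rS -> M' a = M a &
        forall a, a < - 11%:Z \/ 0 <= a -> X' a = X a] /\
    [/\ X' x1 = s.1.1, X' x2 = s.1.2, X' x3 = s.2.1 & X' x4 = s.2.2] /\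
    [/\ X' x6 = dirM s, X' x7 = dirV s, X' x8 = icept s,
        X' x9 = par s s.1 & X' x10 = par s s.2]) M X.
Proof.
move=> hOne hS h1 h2 h3 h4.
have e1 : (4 * i)%N%:Z + 1 = (4 * i)%N.+1%:Z by lia.
have e2 : (4 * i)%N.+1%:Z + 1 = (4 * i)%N.+2%:Z by lia.
have e3 : (4 * i)%N.+2%:Z + 1 = (4 * i)%N.+3%:Z by lia.
do 8!(sx; rewrite ?hS ?hOne ?e1 ?e2 ?e3 ?h1 ?h2 ?h3 ?h4).
do 16!sx.
split; [split|split; split]; look => //.
- by rewrite mulnS; lia.
- by move=> a aS; look.
- by move=> a; case=> a0; look.
Qed.

Lemma wp_store_record M X s (p : int) : M rOne = 1 -> M rZ = 0 -> M rP = p ->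
  p <= - 40%:Z ->
  X x1 = s.1.1 -> X x2 = s.1.2 -> X x3 = s.2.1 -> X x4 = s.2.2 ->
  X x6 = dirM s -> X x7 = dirV s -> X x8 = icept s ->
  X x9 = par s s.1 -> X x10 = par s s.2 ->
  wp store_record 30 (fun _ M' X' =>
    [/\ forall a, a != rT -> M' a = M a,
        forall a, a < p \/ p + 6 < a -> X' a = X a & record_at X' p s]) M X.
Proof.
move=> hOne hZ hP lep h1 h2 h3 h4 h6 h7 h8 h9 h10.
do 7!(sx; rewrite ?hP ?hZ ?hOne ?addr0).
apply: wp_ifR; look; rewrite h9 h10 => sw; rewrite /store4.
  do 7!(sx; rewrite ?hOne); split; last split; last by split; look;
    rewrite /lo_end /hi_end /swapped sw.
  - by move=> a aT; look.
  - by move=> a; case=> ap; look.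
  - by split; look; rewrite /lo_end /hi_end /swapped ?sw.
do 7!(sx; rewrite ?hOne); split; last split; last by split; look;
  rewrite /lo_end /hi_end /swapped (negbTE sw).
- by move=> a aT; look.
- by move=> a; case=> ap; look.
- by split; look; rewrite /lo_end /hi_end /swapped ?(negbTE sw).
Qed.

Lemma record_at_same X X' p s : (forall a, p <= a <= p + 6 -> X' a = X a) ->
  record_at X p s -> record_at X' p s.
Proof.
by move=> H [[h0 h1 h2 h3] [h4 h5 h6]]; split; split; rewrite H //; lia.
Qed.

(** Records grow downwards, so the final frame clause protects the sentinel and the earlier records,
    besides the input. *)
Lemma wp_make_record M X (i : nat) s : M rOne = 1 -> M rZ = 0 -> M rA = 64 ->
  M rI = i%:Z -> M rS = (4 * i)%N%:Z -> M rP = ptr i ->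
  X (4 * i)%N%:Z = s.1.1 -> X (4 * i)%N.+1%:Z = s.1.2 ->
  X (4 * i)%N.+2%:Z = s.2.1 -> X (4 * i)%N.+3%:Z = s.2.2 ->
  wp make_record 60 (fun _ M' X' =>
    [/\ M' rI = i.+1%:Z, M' rS = (4 * i.+1)%N%:Z, M' rP = ptr i.+1 & same 5 M' M] /\
    [/\ M' (64 + i%:Z) = ptr i, forall a, 64 <= a -> a != 64 + i%:Z -> M' a = M a,
        record_at X' (ptr i) s &
        forall a, 0 <= a \/ ptr i + 6 < a < - 20%:Z -> X' a = X a]) M X.
Proof.
move=> hOne hZ hA hI hS hP h1 h2 h3 h4.
have lep : ptr i <= - 40%:Z by rewrite /ptr; lia.
apply: (@wp_seq_mid _ _ _ _ 24 36) => //; first exact: (wp_load_segment hOne hS h1 h2 h3 h4).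
move=> M1 X1 [[hS1 Fr1 FX1] [[g1 g2 g3 g4] [g6 g7 g8 g9 g10]]].
apply: (@wp_seq_mid _ _ _ _ 30 6) => //.
  apply: (wp_store_record (p := ptr i) _ _ _ _ g1 g2 g3 g4 g6 g7 g8 g9 g10) => //; by rewrite Fr1.
move=> M2 X2 [Fr2 FX2 rec].
have Fr a : a != rS -> a != rT -> M2 a = M a by move=> aS aT; rewrite Fr2 ?Fr1.
have hS2 : M2 rS = (4 * i.+1)%N%:Z by rewrite Fr2.
do 5!(sx; rewrite ?hS2 ?Fr // ?hA ?hI ?hP ?hOne).
split; split; look => //.
- by lia.
- by rewrite /ptr; lia.
- by move=> a a5; look; rewrite Fr //; lia.
- by move=> a a64 ai; look; rewrite Fr //; lia.
by move=> a Ha; rewrite FX2; [apply: FX1|]; lia.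
Qed.

Lemma wp_make_records S :
  wp make_records (62 * size S + 12) (fun _ M' X' =>
    [/\ M' rN = (size S)%:Z, M' rOne = 1, M' rZ = 0, M' rA = 64 & M' rB = 64 + (size S)%:Z] /\
    [/\ arr M' 64 (mkseq ptr (size S)), X' (- 32%:Z) = -1 &
        forall i, (i < size S)%N -> record_at X' (ptr i) (nth ((0, 0), (0, 0)) S i)])
   (imem (init_state S)) (rmem (init_state S)).
Proof.
set M := imem _; set X := rmem _; set n := size S.
have hN : M rN = n%:Z by [].
have inX i j : (i < n)%N -> (j < 4)%N ->
    X (4 * i + j)%N%:Z = Defs.coord (nth ((0, 0), (0, 0)) S i) j.
  move=> lt_i lt_j; rewrite /X /= mulnC divnMDl // divn_small // addn0 lt_i.
  by rewrite modnMDl modn_small.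
clearbody M X; apply: (@wp_le _ _ (10 + (62 * n + 2))); first by lia.
do 10!(sx; rewrite ?hN).
pose I (m : nat) M' X' := exists i : nat,
  [/\ (i <= n)%N, (62 * (n - i) + 2 <= m)%N, M' rN = n%:Z, M' rOne = 1 & M' rZ = 0] /\
  [/\ M' rA = 64, M' rB = 64 + n%:Z, M' rI = i%:Z, M' rS = (4 * i)%N%:Z & M' rP = ptr i] /\
  [/\ arr M' 64 (mkseq ptr i), X' (- 32%:Z) = -1, forall a, 0 <= a -> X' a = X a &
      forall j, (j < i)%N -> record_at X' (ptr j) (nth ((0, 0), (0, 0)) S j)].
apply: (@wp_while _ I) => [m M1 X1|m M1 X1|]; last 1 first.
- exists 0%N; split; first by split=> //; look; rewrite ?subn0.
  split; first by split; look; rewrite ?hN.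
  by split; look => // a a0; look.
- case=> i [[le_i le_m hN1 hOne hZ] [[hA hB hI hS hP] [aA sent out recs]]].
  rewrite hI hN1 => lt; exists 60, (62 * (n - i.+1) + 2)%N.
  have lt_i : (i < n)%N by lia.
  split; first lia.
  apply: wp_post.
    apply: (@wp_make_record _ _ i (nth ((0, 0), (0, 0)) S i)) => //; rewrite out //.
    + by rewrite -[(4 * i)%N]addn0 inX.
    + by rewrite -addn1 inX.
    + by rewrite -addn2 inX.
    + by rewrite -addn3 inX.
  move=> _ M2 X2 /= [[hI2 hS2 hP2 sm] [new old rec FX]].
  exists i.+1; split; first by split=> //; rewrite ?sm //; lia.
  split; first by split=> //; rewrite ?sm.
  split.
  + move=> j; rewrite size_mkseq => lt_j; rewrite nth_mkseq //.
    move: lt_j; rewrite ltnS leq_eqVlt => /orP[/eqP->//|lt_j].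
    by rewrite old ?aA ?size_mkseq ?nth_mkseq //; lia.
  + by rewrite FX // /ptr; lia.
  + by move=> a a0; rewrite FX ?out //; left.
  + move=> j; rewrite ltnS leq_eqVlt => /orP[/eqP->//|lt_j].
    apply: record_at_same (recs j lt_j) => a; rewrite /ptr => Ha.
    by apply: FX; rewrite /ptr; lia.
case=> i [[le_i le_m hN1 hOne hZ] [[hA hB hI hS hP] [aA sent out recs]]].
rewrite hI hN1 => ge; have ei : i = n by lia.
split; first lia.
by rewrite ei in aA recs; split; split.
Qed.

End Records.

(** * The greedy scan *)

Definition scan_fields : seq (int * int) := [:: (0, 0); (1, 1); (2, 2); (3, 4)].

(** [rQ] points to the last output and [rP] to the current record; the pair (3, 4) of [scan_fields]
    makes the test compare an upper key with a lower key. The output may overwrite the input, whose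
    data survive in the records. *)
Definition scan_body : cmd :=
  Do (IAdd rT rA rI);; Do (ILoad rP rT);; lexcmp scan_fields;;
  IfI rZ rF
    (Do (IAdd rQ rP rZ);; Do (IConst rT 5);; Do (IAdd rT rP rT);;
     Do (RLoad x1 rT);; Do (RStore rS x1);; Do (IAdd rS rS rOne);; Do (IAdd rT rT rOne);;
     Do (RLoad x1 rT);; Do (RStore rS x1);; Do (IAdd rS rS rOne);; Do (IAdd rC rC rOne))
    Skip;;
  Do (IAdd rI rI rOne).

(** [rQ] starts at the sentinel, the default element of [greedy]. The count ends in [rN] because the
    output decoding reads it from cell 0. *)
Definition scan : cmd :=
  Do (IConst rQ (- 32%:Z));; Do (IConst rC 0);; Do (IConst rI 0);; Do (IConst rS 0);;
  While rI rN scan_body;;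
  Do (IAdd rN rC rZ).

Definition hit_segments : cmd := make_records;; merge_sort;; scan.

Section Scan.
Variables (R : realType) (X0 : int -> R) (n : nat).
Implicit Types (M : int -> int) (X : int -> R) (s out : seq int).

Definition lo_rec_key (p : int) : key R :=
  [:: X0 (p + 0); X0 (p + 1); X0 (p + 2); X0 (p + 4)].

Definition written X out := forall j, (j < size out)%N ->
  X (2 * j)%N%:Z = X0 (nth 0 out j + 5) /\ X (2 * j + 1)%N%:Z = X0 (nth 0 out j + 6).

Lemma wp_scan_body s out M X (bA : int) (i : nat) :
  pointers n s -> 64 <= bA -> (i < n)%N -> {in out, forall p, p <= - 32%:Z} ->
  M rOne = 1 -> M rZ = 0 -> M rA = bA -> M rI = i%:Z -> M rQ = last (- 32%:Z) out ->
  M rC = (size out)%:Z -> M rS = (2 * size out)%N%:Z ->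
  arr M bA s -> agree X X0 -> written X out ->
  let out' := greedy_step lo_rec_key (rec_key X0) (- 32%:Z) out (nth 0 s i) in
  wp scan_body 70 (fun _ M' X' =>
    [/\ M' rI = i.+1%:Z, M' rQ = last (- 32%:Z) out', M' rC = (size out')%:Z &
        M' rS = (2 * size out')%N%:Z] /\
    [/\ same 5 M' M, forall a, 64 <= a -> M' a = M a, agree X' X0 & written X' out']) M X.
Proof.
move=> [sz ptr] bA64 lt_i ptr_out hOne hZ hA hI hQ hC hS arrA XX0 wr /=.
have ei : M (bA + i%:Z) = nth 0 s i by rewrite arrA // sz.
have lep : nth 0 s i <= - 32%:Z by apply: ptr; rewrite mem_nth // sz.
have leq : last (- 32%:Z) out <= - 32%:Z.
  by case: out ptr_out {hQ hC hS wr} => //= x t; apply; rewrite mem_last.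
do 2!(sx; rewrite ?hA ?hI ?ei).
pose p := nth 0 s i; rewrite -/p in lep ei *.
pose q := last (- 32%:Z) out; rewrite -/q in leq hQ *.
apply: (@wp_seq_mid _ _ _ _ 41 20) => //.
  apply: (@wp_lexcmp _ _ (fun M' X' => [/\ M' rF = (rec_key X0 q < lo_rec_key p)%O%:Z,
     M' rP = p, forall a, a != rF -> a != rT -> a != rP -> M' a = M a, agree X' X0 &
     same_out X' X]) _ _ X0) => //.
    move=> [f g] fg; look; rewrite hQ /=.
    by move: fg; rewrite !inE !xpair_eqE /=; clearbody p q; lia.
  move=> M' X'; look; rewrite hQ => F Fr XX0' so; split=> //; first by rewrite Fr //; look.
  by move=> a aF aT aP; rewrite Fr //; look.
move=> M1 X1 [F hP1 Fr XX1 so]; rewrite /greedy_step -/p -/q.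
case: ifP F => _ F; apply: wp_seq; apply: wp_ifI; rewrite F Fr // hZ => // _; last first.
  apply: wp_skip; sx; rewrite Fr // Fr // hI hOne; split; split; look.
  - by lia.
  - by rewrite Fr.
  - by rewrite Fr.
  - by rewrite Fr.
  - by move=> a a5; look; rewrite Fr //; lia.
  - by move=> a a64; look; rewrite Fr //; lia.
  - exact: XX1.
  - by move=> j lt_j; rewrite !so //; apply: wr.
have e5 : X1 (p + 5) = X0 (p + 5) by rewrite XX1 //; clearbody p; lia.
have e6 : X1 (p + 5 + 1) = X0 (p + 6).
  by rewrite XX1; [congr X0|]; clearbody p; lia.
clearbody p q.
do 12!(sx; rewrite ?hP1 ?Fr // ?hOne ?hZ ?hS ?hC ?hI ?addr0 ?e5 ?e6).
rewrite last_rcons size_rcons; split; split; look.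
- by lia.
- by [].
- by lia.
- by lia.
- by move=> a a5; look; rewrite Fr //; lia.
- by move=> a a64; look; rewrite Fr //; lia.
- by move=> a a20; look; apply: XX1.
move=> j; rewrite size_rcons ltnS leq_eqVlt nth_rcons => /orP[/eqP->|lt_j].
  by rewrite ltnn eqxx; look.
by rewrite lt_j; look; rewrite !so //; apply: wr.
Qed.

Lemma wp_scan s M X (bA : int) :
  pointers n s -> 64 <= bA ->
  M rN = n%:Z -> M rOne = 1 -> M rZ = 0 -> M rA = bA -> arr M bA s -> agree X X0 ->
  wp scan (72 * n + 7) (fun _ M' X' =>
    let out := greedy lo_rec_key (rec_key X0) (- 32%:Z) s in
    M' rN = (size out)%:Z /\ written X' out) M X.
Proof.
move=> ptr bA64 hN hOne hZ hA arrA XX0.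
have sz : size s = n by case: ptr.
apply: (@wp_le _ _ (4 + (72 * n + 2 + 1))); first by lia.
do 4!sx.
pose I (m : nat) M' X' := exists i : nat,
  let out := greedy lo_rec_key (rec_key X0) (- 32%:Z) (take i s) in
  [/\ (i <= n)%N, (72 * (n - i) + 2 <= m)%N, M' rI = i%:Z & same 5 M' M] /\
  [/\ M' rQ = last (- 32%:Z) out, M' rC = (size out)%:Z & M' rS = (2 * size out)%N%:Z] /\
  [/\ arr M' bA s, agree X' X0 & written X' out].
apply: (@wp_seq_mid _ (fun M' X' => exists m, I m M' X' /\ ~~ (M' rI < M' rN)) _ _ (72 * n + 2) 1).
- exact: leqnn.
- apply: (@wp_while _ I) => [m M1 X1|m M1 X1|]; last 1 first.
  + exists 0%N; rewrite take0 /=; split.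
      by split=> //; look; rewrite ?subn0 // => a a5; look.
    by split; split=> //; look => // i i_s; look; apply: arrA.
  + case=> i [[le_i le_m hI sm] [[hQ hC hS] [aA XX1 wr]]].
    rewrite hI sm // hN => lt; exists 70, (72 * (n - i.+1) + 2)%N.
    have lt_i : (i < n)%N by lia.
    split; first lia.
    apply: wp_post.
      apply: (@wp_scan_body s _ _ _ bA i _ _ _ _ _ _ _ _ hQ hC hS) => //; rewrite ?sm //.
      by move=> p /greedy_sub/mem_take ps; case: ptr => _; apply.
    move=> _ M2 X2 /= [[hI2 hQ2 hC2 hS2] [sm2 old XX2 wr2]].
    exists i.+1; rewrite (take_nth 0) ?sz // greedy_rcons.
    split; first by split=> //; apply: same_trans sm2 sm.
    split=> //; split=> // j j_s; rewrite old ?aA //; lia.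
  move=> Im ge; split; first by case: Im => i [[_ le_m _ _] _]; lia.
  by exists m.
move=> M1 X1 [_ [[i [[le_i _ hI sm] [[_ hC _] [_ _ wr]]]]]].
rewrite hI sm // hN => ge; have ei : i = n by lia.
rewrite ei -sz take_size in hC wr.
by sx; rewrite (sm rZ) //; look; rewrite hZ hC addr0.
Qed.
End Scan.

(** * Correctness, approximation ratio and total cost *)

Section Correct.
Variables (R : realType) (S : seq (segment R)).

Record sorted_records (X0 : int -> R) (s : seq int) : Prop := SortedRecords {
  records_perm : perm_eq s (mkseq ptr (size S));
  records_sorted : sorted (rec_le X0) s;
  sentinel : X0 (- 32%:Z) = -1;
  records_at : forall i, (i < size S)%N ->
    record_at X0 (ptr i) (nth ((0, 0), (0, 0)) S i) }.

Definition greedy_records (X0 : int -> R) (s : seq int) : seq int :=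
  greedy (lo_rec_key X0) (rec_key X0) (- 32%:Z) s.

Lemma wp_hit_segments :
  wp hit_segments (100 * (size S * up_log 2 (size S)) + 134 * size S + 22)
    (fun _ M' X' => exists X0 s, [/\ sorted_records X0 s,
      M' rN = (size (greedy_records X0 s))%:Z & written X0 X' (greedy_records X0 s)])
   (imem (init_state S)) (rmem (init_state S)).
Proof.
apply: (wp_seq_mid _ (wp_make_records S) (k2 := 100 * (size S * up_log 2 (size S)) + 72 * size S + 10)).
  by lia.
move=> M1 X1 [[hN hOne hZ hA hB] [aA sent recs]].
have ptr_ok : pointers (size S) (mkseq ptr (size S)).
  split; first by rewrite size_mkseq.
  by move=> p /mapP[i _ ->]; rewrite /ptr; lia.
have ap : apart (size S) 64 (64 + (size S)%:Z) by split=> //; split; [lia|left; lia].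
have agX : agree X1 X1 by [].
apply: (wp_seq_mid _ (wp_merge_sort ptr_ok ap hN hOne hZ hA hB aA agX) (k2 := 72 * size S + 7)).
  by lia.
move=> M2 X2 [s [[ps srt XX sm] [A64 aA2]]].
have ptr_s : pointers (size S) s.
  case: ptr_ok => szp H; split; first by rewrite (perm_size ps).
  by move=> p; rewrite (perm_mem ps); apply: H.
apply: wp_post.
  by apply: (wp_scan ptr_s A64 _ _ _ erefl aA2 XX); rewrite sm.
by move=> _ M3 X3 [hN3 wr]; exists X1, s; split=> //; split.
Qed.

Section Geometry.
Variables (X0 : int -> R) (s : seq int).
Hypotheses (S_nondeg : forall g, g \in S -> nondeg g) (recs : sorted_records X0 s).

Lemma record_of p : p \in s -> exists2 g, g \in S &
  [/\ rec_key X0 p = hi_key g, lo_rec_key X0 p = lo_key g &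
      (X0 (p + 5), X0 (p + 6)) = hi_end g].
Proof.
rewrite (perm_mem (records_perm recs)) => /mapP[i]; rewrite mem_iota => lt_i ->.
exists (nth ((0, 0), (0, 0)) S i); first exact: mem_nth.
have [[h0 h1 h2 h3] [h4 h5 h6]] := records_at recs lt_i.
by rewrite /rec_key /lo_rec_key h0 h1 h2 h3 h4 h5 h6 -surjective_pairing.
Qed.

(** The first entries decide: -1 against [dirV], which is never negative. *)
Lemma sentinel_lt : {in s, forall p, rec_key X0 (- 32%:Z) < lo_rec_key X0 p}%O.
Proof.
move=> p /record_of[g _ [_ -> _]].
rewrite /rec_key addr0 (sentinel recs) Order.SeqLexiOrder.ltxi_cons.
have lt : -1 < dirV g by apply: lt_le_trans (dirV_ge0 g); rewrite ltrN10.
by rewrite ltW //= leNgt lt.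
Qed.

Lemma greedy_records_hits :
  hits S [seq (X0 (p + 5), X0 (p + 6)) | p <- greedy_records X0 s].
Proof.
move=> g gS; have lt_i : (index g S < size S)%N by rewrite index_mem.
have ps : ptr (index g S) \in s.
  by rewrite (perm_mem (records_perm recs)) map_f // mem_iota.
have [||] := greedy_hits sentinel_lt _ _ ps.
- by move=> p /record_of[h _ [-> -> _]]; apply: lo_hi_key.
- exact: records_sorted recs.
move=> q qout; have [h hS [-> _ hE]] := record_of (greedy_sub qout).
have [[h0 h1 h2 h3] [h4 _ _]] := records_at recs lt_i.
rewrite /rec_key /lo_rec_key h0 h1 h2 h3 h4 nth_index // => btw.
exists (hi_end h); first by rewrite -hE; apply: map_f.
by apply: hi_end_on_seg btw; apply: S_nondeg.
Qed.

(** The stabbing keys are [point_key d h] for [d] in [D] and [h] in [H]: a segment of direction [d]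
    hit by [h] is stabbed by that key. *)
Lemma size_greedy_records k H : at_most_k_dirs k S -> hits S H ->
  (size (greedy_records X0 s) <= k * size H)%N.
Proof.
move=> [D [Dk [Dnz Ddir]]] HS.
apply: (@leq_trans (size D * size H)); last by rewrite leq_mul2r Dk orbT.
rewrite -(size_allpairs (@point_key R) D H).
apply: size_greedy sentinel_lt _ => p /record_of[g gS [-> -> _]].
have [d dD gd] := Ddir g gS; have [h hH hg] := HS g gS.
exists (point_key d h); first exact: allpairs_f.
by apply: point_key_between => //; [apply: S_nondeg | apply: Dnz].
Qed.
End Geometry.
End Correct.

Theorem mainTheorem1 (R : realType) :
  exists (P : program) (C : nat),
    forall (k : nat) (S : seq (segment R)),
      (forall s, s \in S -> nondeg s) ->
      at_most_k_dirs k S ->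
      exists t : nat,
        (t <= C * (size S * up_log 2 (size S) + 1))%N /\
        let s := iter t (step P) (init_state S) in
        halted P s /\
        hits S (output s) /\
        (forall H : seq (point R), hits S H ->
           (size (undup (output s)) <= k * size H)%N).
Proof.
(* With n segments and L = [up_log 2 n], the cost 100 n L + 134 n + 22 is at most 234 n L + 156,
   since n <= n L + 1. *)
exists (compile 0 hit_segments), 300%N => k S S_nondeg S_dirs.
have [t [le_t [hlt [_ [X0 [s [recs hN wr]]]]]]] := wp_halts (wp_hit_segments S).
exists t; split.
  (* From two segments on the logarithm is at least 1; below that the summand 1 suffices. *)
  have le_log : (size S <= size S * up_log 2 (size S) + 1)%N.
    have [le1|lt1] := leqP (size S) 1; first by apply: leq_trans (leq_addl _ _).
    apply: leq_trans (leq_addr _ _); rewrite leq_pmulr // up_log_gt0 lt1 //.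
  by lia.
have outE : output (iter t (step (compile 0 hit_segments)) (init_state S)) =
    [seq (X0 (p + 5), X0 (p + 6)) | p <- greedy_records X0 s].
  rewrite /output hN; apply: (@eq_from_nth _ (0, 0)); rewrite ?size_map ?size_iota //.
  move=> j lt_j; rewrite (nth_map 0%N) ?size_iota // nth_iota // add0n.
  by rewrite (nth_map 0) //; have [-> ->] := wr j lt_j.
split; [exact: hlt | rewrite outE; split].
  exact: greedy_records_hits S_nondeg recs.
move=> H HS; apply: leq_trans (size_undup _) _.
by rewrite size_map; exact: (size_greedy_records S_nondeg recs S_dirs HS).
Qed.
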